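(* Let $d\ge 1$ and let $\Delta$ be a unit-interval $d$-dimensional simplicial complex such that the deletion of $d$ or fewer vertices (possibly none), however chosen, yields a strongly-connected $d$-dimensional simplicial complex. Then $\Delta$ is Hamiltonian.
   Context: A labeling of a simplicial complex with $n$ vertices is a bijection of its vertex set with $\{1,\dots,n\}$. The deletion of a set of vertices from $\Delta$ is the subcomplex of all faces of $\Delta$ containing none of these vertices. A pure $d$-dimensional simplicial complex is strongly-connected if its dual graph is connected; the dual graph has the facets as nodes, and two facets are joined by an arc iff their intersection has cardinality $d$. Strongly-connected complexes are by convention pure. A pure $d$-dimensional simplicial complex $\Delta$ with $n$ vertices is unit-interval if there is a labeling such that for every $d$-face $F=\{a_0<a_1<\dots<a_d\}$ of $\Delta$, every $(d+1)$-element subset of $\{a_0,a_0+1,\dots,a_d\}$ is a face of $\Delta$. A $d$-dimensional simplicial complex $\Delta$ with $n$ vertices is Hamiltonian if it has a labeling such that for all $i=1,\dots,n$ the set $H_i=\{i,i+1,\dots,i+d\}$, with labels read modulo $n$ (so $n+1$ means $1$, etc.), is a face of $\Delta$. *)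

(* Defs.v *)
From mathcomp Require Import all_boot.

Set Implicit Arguments.
Unset Strict Implicit.
Unset Printing Implicit Defensive.

(* A finite abstract simplicial complex.  The points of the ambient type T need
   not all be vertices, so that a deletion lives on the same type. *)
Record simplicial_complex (T : finType) := SimplicialComplex {
  faces : {set {set T}};
  faces0 : set0 \in faces;
  faces_sub : forall F G : {set T}, F \in faces -> G \subset F -> G \in faces
}.

Section Complexes.

Variable T : finType.
Implicit Types (K : simplicial_complex T) (d : nat) (F G S : {set T}).

Definition vertices K : {set T} := [set v | [set v] \in faces K].

Definition facet K F : bool := maxset (fun G => G \in faces K) F.

Definition has_dim d K : Prop := \max_(F in faces K) #|F| = d.+1.

Definition pure_dim d K : Prop :=
  has_dim d K /\ forall F, facet K F -> #|F| = d.+1.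

Lemma deletion0 K S : set0 \in [set F in faces K | [disjoint F & S]].
Proof. by rewrite inE faces0 -setI_eq0 set0I eqxx. Qed.

Lemma deletion_sub K S F G :
  F \in [set F in faces K | [disjoint F & S]] -> G \subset F ->
  G \in [set F in faces K | [disjoint F & S]].
Proof.
rewrite !inE => /andP[KF dFS] sGF.
by rewrite (faces_sub KF sGF) (disjointWl sGF dFS).
Qed.

Definition deletion K S : simplicial_complex T :=
  SimplicialComplex (@deletion0 K S) (@deletion_sub K S).

Definition dual_arc d K : rel {set T} :=
  [rel F G | [&& facet K F, facet K G & #|F :&: G| == d]].

Definition strongly_connected d K : Prop :=
  pure_dim d K /\
  forall F G, facet K F -> facet K G -> connect (dual_arc d K) F G.

(* As iota 1 n is duplicate-free, perm_eq says that l restricts to a bijection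
   from the vertices onto {1, ..., n}; values off the vertices are junk. *)
Definition labeling K (l : T -> nat) : Prop :=
  perm_eq [seq l v | v in vertices K] (iota 1 #|vertices K|).

(* Here a and b are the vertices of F with least and greatest labels. *)
Definition unit_interval d K : Prop :=
  pure_dim d K /\
  exists l : T -> nat, labeling K l /\
    forall F a b, F \in faces K -> #|F| = d.+1 -> a \in F -> b \in F ->
      (forall v, v \in F -> l a <= l v <= l b) ->
      forall G, G \subset [set v in vertices K | l a <= l v <= l b] ->
        #|G| = d.+1 -> G \in faces K.

(* Labels lie in {1, ..., n}, so a congruence mod n determines the vertex. *)
Definition cyclic_window K (l : T -> nat) d i : {set T} :=
  [set v in vertices K |
    [exists j : 'I_d.+1, l v == i + j %[mod #|vertices K|]]].

Definition hamiltonian d K : Prop :=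
  has_dim d K /\
  exists l : T -> nat, labeling K l /\
    forall i, 1 <= i <= #|vertices K| -> cyclic_window K l d i \in faces K.

End Complexes.

(* Main.v *)
Require Import Defs.
From mathcomp Require Import all_boot.
From mathcomp Require Import zify.

(** Let l be a unit-interval labeling.  Deleting the d vertices labeled
    i+1, ..., i+d leaves a strongly connected complex, and on a dual path from
    a facet through the last vertex to a facet through the vertex labeled i the
    number of vertices labeled at most i grows by at most one per step.  So some
    facet has a label <= i and a label >= i + 2d; hence every d+1 vertices whose
    labels differ by at most 2d form a face.  In the cyclic order
    1, 3, 5, ..., 6, 4, 2 neighbours differ by at most 2, so any d+1 consecutive
    vertices have this property. *)

(** * Counting vertices by labels, and labels modulo the number of vertices *)

Section Labelings.

Context {T : finType} {K : simplicial_complex T} {l : T -> nat}.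
Hypothesis lK : labeling K l.

Lemma labeling_inj : {in vertices K &, injective l}.
Proof. by apply/dinjectiveP; rewrite /dinjectiveb (perm_uniq lK) iota_uniq. Qed.

Lemma labeling_bounds v : v \in vertices K -> 1 <= l v <= #|vertices K|.
Proof.
move=> Kv; have : l v \in iota 1 #|vertices K|.
  by rewrite -(perm_mem lK) image_f.
by rewrite mem_iota; lia.
Qed.

Lemma labeling_surj x :
  1 <= x <= #|vertices K| -> exists2 v, v \in vertices K & l v = x.
Proof.
move=> x_n; have : x \in [seq l v | v in vertices K].
  by rewrite (perm_mem lK) mem_iota; lia.
by case/imageP=> v Kv ->; exists v.
Qed.

(** Labels are distinct on vertices, so [A] injects into [p + 1, ..., p + m]. *)
Lemma card_label_interval (A : {set T}) p m :
    A \subset vertices K -> (forall v, v \in A -> p < l v <= p + m) ->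
  #|A| <= m.
Proof.
move=> /subsetP sAK Apm; rewrite -(size_iota p.+1 m) -(size_image l A).
apply: uniq_leq_size.
  by apply/dinjectiveP=> u v /sAK Ku /sAK Kv; apply: labeling_inj.
by move=> _ /imageP[v /Apm lv ->]; rewrite mem_iota; lia.
Qed.

Lemma labeling_modn_inj u v : u \in vertices K -> v \in vertices K ->
  l u = l v %[mod #|vertices K|] -> u = v.
Proof.
move=> Ku Kv /eqP eq_uv; apply: labeling_inj => //; move: eq_uv.
have [/andP[u_gt0 u_n] /andP[v_gt0 v_n]] := (labeling_bounds _ Ku, labeling_bounds _ Kv).
(* Lowering both labels by one puts them below the modulus, where reduction is the identity. *)
rewrite -(prednK u_gt0) -(prednK v_gt0) -[_.-1.+1]addn1 -[(l v).-1.+1]addn1.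
rewrite eqn_modDr !modn_small; lia.
Qed.

Lemma labeling_modn_surj m : 0 < #|vertices K| ->
  exists v, v \in vertices K /\ l v = m %[mod #|vertices K|].
Proof.
move=> n_gt0; have r_n : m %% #|vertices K| < #|vertices K| by rewrite ltn_mod.
(* Labels start at 1, so residue 0 is realised by the largest label. *)
have [r0|r_neq0] := eqVneq (m %% #|vertices K|) 0.
  have [v Kv lv] := labeling_surj #|vertices K| ltac:(lia).
  by exists v; rewrite lv modnn r0.
have [v Kv lv] := labeling_surj (m %% #|vertices K|) ltac:(lia).
by exists v; rewrite lv modn_mod.
Qed.

(** As [d < #|vertices K|], the residues of [i, ..., i + d] are distinct, and each belongs to
    exactly one vertex. *)
Lemma card_cyclic_window d i :
  d < #|vertices K| -> #|cyclic_window K l d i| = d.+1.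
Proof.
move=> d_n; have n_gt0 : 0 < #|vertices K| by lia.
have [f fP] := fin_all_exists (fun j : 'I_d.+1 => labeling_modn_surj (i + j) n_gt0).
have f_inj : injective f.
  move=> j k eq_f; apply/val_inj/eqP; move: (fP j).2; rewrite eq_f (fP k).2.
  by move/eqP; rewrite eqn_modDl !modn_small ?(leq_trans (ltn_ord _)) // eq_sym.
rewrite -[RHS]card_ord -(card_imset _ f_inj); apply: eq_card => v.
apply/setIdP/imsetP => [[Kv /existsP[j /eqP lv]]|[j _ ->]].
  exists j => //; have [Kf lf] := fP j.
  by apply: labeling_modn_inj => //; rewrite lf.
by have [Kf lf] := fP j; split=> //; apply/existsP; exists j; rewrite lf.
Qed.

End Labelings.

Lemma face_sub_vertices (T : finType) (K : simplicial_complex T) F :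
  F \in faces K -> F \subset vertices K.
Proof.
by move=> KF; apply/subsetP=> v Fv; rewrite inE (faces_sub KF) ?sub1set.
Qed.

Lemma vertex_in_facet (T : finType) (K : simplicial_complex T) v :
  v \in vertices K -> exists2 F, facet K F & v \in F.
Proof.
rewrite inE => Kv; have [F maxF sF] := maxset_exists (P := fun G => G \in faces K) Kv.
by exists F; rewrite // -sub1set.
Qed.

Lemma has_dim_face (T : finType) (K : simplicial_complex T) d :
  has_dim d K -> exists2 F, F \in faces K & #|F| = d.+1.
Proof.
move=> dimK; have K0 : 0 < #|faces K| by apply/card_gt0P; exists set0; apply: faces0.
have [F KF maxF] := eq_bigmax_cond (fun F : {set T} => #|F|) K0.
by exists F; rewrite // -maxF.
Qed.

(** * Facets with a wide label range, and faces with nearby labels *)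

Section WideFaces.

Context {T : finType} {K : simplicial_complex T} {d : nat} {l : T -> nat}.
Hypothesis lK : labeling K l.
Hypothesis K_del : forall S : {set T}, S \subset vertices K -> #|S| <= d ->
  strongly_connected d (deletion K S).

Let n := #|vertices K|.
Let block p := [set v in vertices K | p < l v <= p + d].

Lemma block_deletion p : strongly_connected d (deletion K (block p)).
Proof.
have sB : block p \subset vertices K by apply/subsetP=> v /setIdP[].
apply: K_del => //; apply: (card_label_interval lK _ p d sB) => v.
by rewrite inE => /andP[].
Qed.

Lemma face_block_deletion p F : F \in faces (deletion K (block p)) ->
  [/\ F \in faces K, F \subset vertices K &
      forall v, v \in F -> (l v <= p) || (p + d < l v)].
Proof.
rewrite inE => /andP[KF dF]; have sF := face_sub_vertices _ _ _ KF.
split=> // v Fv; move: (disjointFr dF Fv); rewrite inE (subsetP sF) //=; lia.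
Qed.

(** Deleting the labels [1, ..., d] leaves a face of [d.+1] vertices, with labels among
    [d + 1, ..., n]. *)
Lemma card_vertices_ge : d.*2 < n.
Proof.
have [[dimB _] _] := block_deletion 0.
have [F BF cF] := has_dim_face _ _ _ dimB.
have [_ sF lF] := face_block_deletion _ _ BF.
suff : #|F| <= n - d by rewrite cF; lia.
apply: (card_label_interval lK _ d _ sF) => v Fv.
have := labeling_bounds lK v (subsetP sF v Fv).
have := lF v Fv; rewrite -/n; lia.
Qed.

Hypothesis d_gt0 : 0 < d.

(** If no facet of [D] were wide, lying above [i] would be invariant along dual arcs. A facet
    through label [n] has this property and one through label [i] lacks it, against
    connectedness. *)
Lemma wide_face i : 1 <= i -> i + d.*2 <= n ->
  exists F u w, [/\ F \in faces K, #|F| = d.+1, u \in F, w \in F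
                  & l u <= i /\ i + d.*2 <= l w].
Proof.
move=> i_gt0 i_n; set D := deletion K (block i).
have [[_ pureD] connD] := block_deletion i.
have facetD F : facet D F -> F \in faces D by move/maxsetp.
have vertexD v : v \in vertices K -> (l v <= i) || (i + d < l v) ->
    exists2 F, facet D F & v \in F.
  move=> Kv lv; apply: vertex_in_facet; move: (Kv); rewrite !inE => ->/=.
  by rewrite disjoints1 inE Kv /=; lia.
pose wide F u w := [&& facet D F, u \in F, w \in F, l u <= i & i + d.*2 <= l w].
have [/existsP[F /existsP[u /existsP[w]]]|noF] :=
    boolP [exists F : {set T}, exists u, exists w, wide F u w].
  case/and5P=> DF Fu Fw lu lw; exists F, u, w.
  have [KF _ _] := face_block_deletion _ _ (facetD _ DF).
  by split=> //; apply: pureD.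
have {}noF F u w : ~~ wide F u w.
  by apply: contra noF => FP; do 3![apply/existsP; eexists]; apply: FP.
pose high := [pred F : {set T} | [forall v in F, i < l v]].
have [u Ku lu] := labeling_surj lK i ltac:(rewrite -/n; lia).
have [w Kw lw] := labeling_surj lK n ltac:(rewrite -/n; lia).
have [Fu DFu uFu] := vertexD u Ku ltac:(lia).
have [Fw DFw wFw] := vertexD w Kw ltac:(lia).
have highE (F : {set T}) : reflect (forall v, v \in F -> i < l v) (F \in high).
  exact: forall_inP.
have highFw : Fw \in high.
  (* Since [l w = n >= i + d.*2], a label at most [i] in [Fw] would make it wide. *)
  apply/highE=> v Fv; rewrite ltnNge; apply/negP=> lv.
  by move: (noF Fw v w); rewrite /wide DFw Fv wFw lv; lia.
suff closed_high : closed (dual_arc d D) high.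
  have := closed_connect closed_high (connD _ _ DFw DFu).
  rewrite highFw => /esym/highE/(_ u uFu); lia.
apply: intro_closed => [|F G].
  by apply: sym_connect_sym => F G; rewrite /dual_arc /= setIC andbCA.
case/and3P=> DF DG /eqP cFG highF; apply/highE=> u' Gu'.
rewrite ltnNge; apply/negP=> lu'.
have [_ sF lF] := face_block_deletion _ _ (facetD _ DF).
(* [F] lies above [i] and avoids the block, hence lies above [i + d]; [G] contains [u'] and is not
   wide, hence lies below [i + d.*2]. Only [d.-1] labels are left for the intersection. *)
suff : #|F :&: G| <= d.-1 by rewrite cFG leqNgt prednK // leqnn.
apply: (card_label_interval lK _ (i + d)); first by rewrite subIset ?sF.
move=> v /setIP[Fv Gv].
move: (noF G u' v); rewrite /wide DG Gu' Gv lu' /= -ltnNge.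
move: (lF v Fv) (highE _ highF v Fv) d_gt0; clear; lia.
Qed.

Hypothesis K_fill : forall F a b, F \in faces K -> #|F| = d.+1 ->
  a \in F -> b \in F -> (forall v, v \in F -> l a <= l v <= l b) ->
  forall G : {set T}, G \subset [set v in vertices K | l a <= l v <= l b] ->
    #|G| = d.+1 -> G \in faces K.

Lemma close_labels_face (G : {set T}) :
    G \subset vertices K -> #|G| = d.+1 ->
    {in G &, forall u v, l v <= l u + d.*2} -> G \in faces K.
Proof.
move=> sG cG closeG; have [g0 Gg0] : exists g, g \in G by apply/card_gt0P; rewrite cG.
have [g Gg min_g] := arg_minnP l Gg0.
have n_gt := card_vertices_ge.
have [g_gt0 g_n] := andP (labeling_bounds lK g (subsetP sG g Gg)).
(* The cap ensures [i + d.*2 <= n]. Where it takes effect, [i + d.*2] equals [n] and still bounds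
   every label of [G]. *)
pose i := minn (l g) (n - d.*2).
have [F [u [w [KF cF Fu Fw [lu lw]]]]] :
    exists F u w, [/\ F \in faces K, #|F| = d.+1, u \in F, w \in F
                    & l u <= i /\ i + d.*2 <= l w].
  by apply: wide_face; rewrite /i; lia.
have [a Fa min_a] := arg_minnP l Fu; have [b Fb max_b] := arg_maxnP l Fw.
apply: (K_fill F a b) => //.
  by move=> v Fv; rewrite min_a //=; apply: max_b.
apply/subsetP=> v Gv; have Kv := subsetP sG v Gv; rewrite inE Kv /=.
have := labeling_bounds lK v Kv; have := closeG g v Gg Gv; have := min_g v Gv.
have := min_a u Fu; have : l w <= l b := max_b w Fw.
rewrite -/n; move: lu lw g_n n_gt; rewrite /i -/n; clear; lia.
Qed.

End WideFaces.

(** * The zigzag cyclic order on [1, ..., n] *)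

Section ZigZag.

Variable n : nat.
Hypothesis n_gt1 : 1 < n.

(* Position of x in the cyclic order 1, 3, 5, ..., 6, 4, 2. *)
Definition zigzag x := if odd x then uphalf x else n.+1 - x./2.

(* Entry of that order at position m mod n; positions 0 and n coincide. *)
Definition zigzag_at m :=
  let r := m %% n in
  if r == 0 then 2 else if r <= uphalf n then r.*2.-1 else (n.+1 - r).*2.

Lemma zigzagK x : 1 <= x <= n -> zigzag_at (zigzag x) = x.
Proof.
move=> x_n; rewrite /zigzag_at.
(* Position [n] reduces to residue 0; as [n > 1], only [x = 2] sits there. *)
have [xn|xn] : zigzag x = n \/ zigzag x < n by rewrite /zigzag; case: ifP; lia.
  by rewrite xn modnn /=; move: xn; rewrite /zigzag; case: ifP; lia.
by rewrite modn_small //; move: xn; rewrite /zigzag; do !case: ifP; lia.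
Qed.

(** By [zigzagK] the map is injective, and it sends the finite set [1, ..., n] into itself. *)
Lemma perm_zigzag : perm_eq (map zigzag (iota 1 n)) (iota 1 n).
Proof.
have uniq_z : uniq (map zigzag (iota 1 n)).
  rewrite map_inj_in_uniq ?iota_uniq // => x y; rewrite !mem_iota => xn yn eq_z.
  by rewrite -[x]zigzagK ?eq_z ?zigzagK //; lia.
apply: uniq_perm (iota_uniq _ _) _ => //.
apply: (uniq_min_size uniq_z _ _).2; last by rewrite size_map.
by move=> _ /mapP[x + ->]; rewrite !mem_iota /zigzag; case: ifP; lia.
Qed.

Lemma zigzag_at_mod m m' : m = m' %[mod n] -> zigzag_at m = zigzag_at m'.
Proof. by rewrite /zigzag_at => ->. Qed.

(** Steps within the odd or the even run have size 2; the turn between [n.-1] and [n] and the wrap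
    from 2 to 1 have size 1. *)
Lemma zigzag_at_step m : zigzag_at m.+1 <= zigzag_at m + 2 /\
                         zigzag_at m <= zigzag_at m.+1 + 2.
Proof.
have r_n : m %% n < n by rewrite ltn_mod; lia.
rewrite /zigzag_at -(addn1 m) -modnDml addn1.
move: (m %% n) r_n => r r_n; have [eq_n|neq_n] := eqVneq r.+1 n.
  by rewrite eq_n modnn /=; do !case: ifP; lia.
by rewrite modn_small; do ?case: ifP; lia.
Qed.

Lemma zigzag_at_close m k : zigzag_at (m + k) <= zigzag_at m + k.*2 /\
                            zigzag_at m <= zigzag_at (m + k) + k.*2.
Proof.
elim: k => [|k IHk]; first by rewrite addn0 double0 addn0.
by rewrite addnS; have := zigzag_at_step (m + k); lia.
Qed.

End ZigZag.

Theorem theorem4 (T : finType) (K : simplicial_complex T) (d : nat)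
    (hd : 1 <= d)
    (hK : unit_interval d K)
    (hdel : forall S : {set T}, S \subset vertices K -> #|S| <= d ->
       strongly_connected d (deletion K S)) :
  hamiltonian d K.
Proof.
have [[dimK _] [l [lK fillK]]] := hK; split=> //.
have n_gt := card_vertices_ge lK hdel; set n := #|vertices K| in n_gt *.
have n_gt1 : 1 < n by lia.
have zlK : labeling K (zigzag n \o l).
  rewrite /labeling /image_mem (map_comp (zigzag n) l).
  exact: perm_trans (perm_map _ lK) (perm_zigzag n n_gt1).
exists (zigzag n \o l); split=> // i _.
(* Windows are runs of zigzag positions; inverting [zigzag] recovers the original labels, on which
   closeness is measured. *)
have windowE v : v \in cyclic_window K (zigzag n \o l) d i ->
    exists j : 'I_d.+1, l v = zigzag_at n (i + j).
  case/setIdP=> Kv /existsP[j /eqP lv]; exists j.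
  by rewrite -(zigzag_at_mod _ _ _ lv) zigzagK //; apply: (labeling_bounds lK).
apply: (close_labels_face lK hdel hd fillK).
- by apply/subsetP=> v /setIdP[].
- by rewrite (card_cyclic_window zlK) // -/n; lia.
(* The two positions differ by at most [d], so the original labels differ by at most [d.*2]. *)
move=> u v /windowE[j ->] /windowE[k ->].
have [j_d k_d] := (ltn_ord j, ltn_ord k); case: (leqP j k) => jk.
  have := zigzag_at_close n n_gt1 (i + j) (k - j).
  by rewrite -addnA subnKC //; lia.
have := zigzag_at_close n n_gt1 (i + k) (j - k).
by rewrite -addnA subnKC; lia.
Qed.
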